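(* Let $\tau>0$ and $c\geq 0$ be constants independent of $n$ and $q$. Suppose that for all constants $q$ (positive integers) there exists a trilinear algorithm for $\Delta(f,g,h)$, on inputs $f,g,h:\binom{U}{q}\to\mathbb{Z}$ over an $n$-element set $U$, with rank $r=O\bigl(n^{3q(1/2-\tau)+c}\bigr)$ over the integers. Then $\omega\leq 3-\tau$.
   Context: $\binom{U}{q}$ denotes the set of all $q$-element subsets of $U$, and $$\Delta(f,g,h)=\sum_{\substack{A,B,C\in\binom{U}{q}\\ A\cap B=A\cap C=B\cap C=\emptyset}} f(A)\,g(B)\,h(C).$$ A trilinear algorithm of rank $r$ over the integers for $\Delta$ (for given $q$ and $n$) consists of coefficients $\lambda_s,\alpha_{s,A},\beta_{s,B},\gamma_{s,C}\in\mathbb{Z}$ for $s=1,\ldots,r$ and $A,B,C\in\binom{U}{q}$ such that, for all $f,g,h$, $$\Delta(f,g,h)=\sum_{s=1}^r\lambda_s\Bigl(\sum_{A\in\binom{U}{q}}\alpha_{s,A}f(A)\Bigr)\Bigl(\sum_{B\in\binom{U}{q}}\beta_{s,B}\,g(B)\Bigr)\Bigl(\sum_{C\in\binom{U}{q}}\gamma_{s,C}h(C)\Bigr).$$ The hypothesis means that for each fixed $q$ such algorithms exist for every $n$, with rank $r=r(n)$ satisfying the stated bound as $n\to\infty$ (the hidden constant may depend on $q$). $\omega$ is the limiting exponent of square matrix multiplication: the infimum of the reals $w$ such that two $N\times N$ integer matrices can be multiplied using $O(N^{w})$ arithmetic operations (addition, subtraction, multiplication, and exact division of integers). *)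

(* Defs.v *)
From mathcomp Require Import all_boot all_order all_algebra.
From mathcomp Require Import all_classical all_reals all_analysis.
Import Order.TTheory GRing.Theory Num.Theory.
Import numFieldNormedType.Exports.
Set Implicit Arguments.
Unset Strict Implicit.
Unset Printing Implicit Defensive.
Local Open Scope classical_set_scope.
Local Open Scope ring_scope.

(* The functions n |-> a n and n |-> n ^ e, seen in the normed module R^o
   so that the Landau notation of the library applies. *)
Definition bigO_power (R : realType) (a : nat -> nat) (e : R) : Prop :=
  (fun n : nat => (a n)%:R : R^o) =O_\oo (fun n : nat => n%:R `^ e : R^o).

Section DisjointTriples.
Variables (U : finType) (q : nat).

Definition qsubset := {A : {set U} | #|A| == q}.

Definition disjoint_triple (A B C : qsubset) : bool :=
  [&& val A :&: val B == finset.set0, val A :&: val C == finset.set0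
    & val B :&: val C == finset.set0]%SET.

Definition Delta (f g h : qsubset -> int) : int :=
  \sum_(A : qsubset) \sum_(B : qsubset) \sum_(C : qsubset | disjoint_triple A B C)
    f A * g B * h C.

Definition trilinear_algorithm (r : nat) : Prop :=
  exists (lambda : 'I_r -> int) (alpha beta gamma : 'I_r -> qsubset -> int),
    forall f g h : qsubset -> int,
      Delta f g h =
      \sum_(s < r) lambda s * (\sum_(A : qsubset) alpha s A * f A)
                            * (\sum_(B : qsubset) beta s B * g B)
                            * (\sum_(C : qsubset) gamma s C * h C).

End DisjointTriples.

(* Straight-line programs over the integers whose inputs are the entries of two
   N x N matrices.  Inputs and integer constants are free; each instruction is
   one arithmetic operation. *)
Section StraightLinePrograms.
Variable N : nat.

Inductive operand :=
  | LeftEntry of 'I_N & 'I_N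
  | RightEntry of 'I_N & 'I_N
  | Constant of int
  | Result of nat. (* result of the k-th instruction, counted from 0 *)

Inductive arith_op := Add | Sub | Mul | ExactDiv.

Record instruction :=
  Instruction { op : arith_op; arg1 : operand; arg2 : operand }.

Definition eval_op (o : arith_op) (x y : int) : option int :=
  match o with
  | Add => Some (x + y)
  | Sub => Some (x - y)
  | Mul => Some (x * y)
  | ExactDiv => if (y != 0) && (y %| x)%Z then Some (x %/ y)%Z else None
  end.

Definition eval_operand (A B : 'M[int]_N) (results : seq int) (a : operand) :
    option int :=
  match a with
  | LeftEntry i j => Some (A i j)
  | RightEntry i j => Some (B i j)
  | Constant z => Some z
  | Result k => onth results k
  end.

(* [None] signals a division that is not exact, or a reference to a result that
   has not been computed yet. *)
Fixpoint run (A B : 'M[int]_N) (results : seq int) (p : seq instruction) :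
    option (seq int) :=
  if p is i :: p' then
    match eval_operand A B results (arg1 i), eval_operand A B results (arg2 i) with
    | Some x, Some y =>
        if eval_op (op i) x y is Some z then run A B (rcons results z) p'
        else None
    | _, _ => None
    end
  else Some results.

Definition multiplies (p : seq instruction) (out : 'I_N -> 'I_N -> operand) :
    Prop :=
  forall A B : 'M[int]_N, exists2 results : seq int,
    run A B [::] p = Some results &
    forall i j, eval_operand A B results (out i j) = Some ((A *m B) i j).

Definition mulmx_in_ops (t : nat) : Prop :=
  exists (p : seq instruction) (out : 'I_N -> 'I_N -> operand),
    size p = t /\ multiplies p out.

End StraightLinePrograms.

Definition mulmx_exponent (R : realType) (w : R) : Prop :=
  exists t : nat -> nat, (forall N : nat, mulmx_in_ops N (t N)) /\ bigO_power t w.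

(* The infimum is taken in \bar R, so that it is meaningful without a separate
   proof that the set is nonempty and bounded below. *)
Definition omega (R : realType) : \bar R :=
  ereal_inf [set w%:E | w in [set w : R | mulmx_exponent w]].

(* Main.v *)
(* Let X have p elements and Y have b elements, and let m = b^p be the number of
   functions s : X -> Y.  Over a universe with three copies of X * Y, the union
   of the graphs of s and t in two different copies is a set of size q = 2p.
   Restricting f, g and h to the sets coming from the copies (0,1), (1,2) and
   (2,0) turns Delta into the tensor of m x m matrix multiplication, twisted by
   the matrix D(s,t) = [s and t agree nowhere] in each of the three indices.
   D is the p-th tensor power of J - I, hence invertible up to the integer factor
   (b-1)^p, so an algorithm of rank r for Delta yields one of rank r for a nonzero
   integer multiple of the m x m matrix product; exact division removes the
   multiple.  The universe has n = 3pb points, so for fixed p with p tau > c the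
   hypothesis gives r = O(b^(p(3-6tau)+c)) < m^(3-5tau) once b is large.  As
   r >= 1, this excludes tau >= 1, and for tau < 1 the exponent 3-tau exceeds 2,
   so that the recursion on blocks in the manner of Strassen costs O(N^(3-tau)). *)
Require Import Defs.
From mathcomp Require Import all_boot all_order all_algebra.
From mathcomp Require Import all_classical all_reals all_analysis.
From mathcomp Require Import zify ring lra.
Import Order.TTheory GRing.Theory Num.Theory.
Import numFieldNormedType.Exports.
Set Implicit Arguments.
Unset Strict Implicit.
Unset Printing Implicit Defensive.
Local Open Scope ring_scope.

(** * A cost calculus for straight-line programs *)

(* A value is the function of the two input matrices that an operand denotes. *)
Definition value (N : nat) := 'M[int]_N -> 'M[int]_N -> int.

Definition results_of {N} (vs : seq (value N)) (A B : 'M[int]_N) : seq int :=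
  [seq v A B | v <- vs].

Definition known {N} (vs : seq (value N)) (v : value N) : Prop :=
  exists o : operand N, forall A B, eval_operand A B (results_of vs A B) o = Some (v A B).

(** The program is chosen before the inputs, so that one program serves all pairs of matrices;
    [size vs] is its operation count. *)
Definition derivable {N} (vs : seq (value N)) : Prop :=
  exists2 p : seq (instruction N), size p = size vs &
    forall A B, run A B [::] p = Some (results_of vs A B).

Lemma known_const {N} (vs : seq (value N)) (z : int) : known vs (fun _ _ => z).
Proof. by exists (Constant N z). Qed.

(** New results are appended at the end, so an index that was valid keeps its meaning. *)
Lemma known_cat {N} (vs ws : seq (value N)) v : known vs v -> known (vs ++ ws) v.
Proof.
move=> [a ha]; exists a; move=> A B; move: (ha A B).
case: a {ha} => //= k; rewrite /results_of map_cat onth_cat.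
by case: ifP => // kn; rewrite onth_default // leqNgt kn.
Qed.

Lemma run_cat {N} (A B : 'M[int]_N) rs (p q : seq (instruction N)) :
  run A B rs (p ++ q) = obind (fun rs' => run A B rs' q) (run A B rs p).
Proof.
elim: p rs => //= i p IHp rs.
case: (eval_operand _ _ _ (arg1 i)) => // x.
case: (eval_operand _ _ _ (arg2 i)) => // y.
by case: (eval_op _ _ _).
Qed.

Lemma derivable_rcons {N} (vs : seq (value N)) o (x y z : value N) :
  derivable vs -> known vs x -> known vs y ->
  (forall A B, eval_op o (x A B) (y A B) = Some (z A B)) ->
  derivable (rcons vs z) /\ known (rcons vs z) z.
Proof.
move=> [p sp hp] [ox hx] [oy hy] hz; split.
  exists (rcons p (Instruction o ox oy)); first by rewrite !size_rcons sp.
  move=> A B; rewrite -cats1 run_cat hp /= hx hy hz.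
  by rewrite /results_of map_rcons.
exists (Result N (size vs)); move=> A B /=.
by rewrite /results_of map_rcons -cats1 onth_cat size_map ltnn subnn.
Qed.

(* Whenever the values in K are available, at most t further instructions make
   those in L available.  The context N is kept fixed, so that a recursive
   multiplication acts on computed values and programs are never relocated. *)
Definition cost {N} (K : set (value N)) (t : nat) (L : set (value N)) : Prop :=
  forall vs, derivable vs -> (forall v, K v -> known vs v) ->
  exists ws, [/\ derivable (vs ++ ws), (size ws <= t)%N
                 & forall v, L v -> known (vs ++ ws) v].

Lemma cost_mono {N} (K K' L L' : set (value N)) t t' :
  (K `<=` K')%classic -> (t <= t')%N -> (L' `<=` L)%classic ->
  cost K t L -> cost K' t' L'.
Proof.
move=> KK tt LL h vs dvs hK; have [|ws [d s k]] := h vs dvs.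
  by move=> v /KK; apply: hK.
by exists ws; split => //; [exact: leq_trans tt|move=> v /LL; exact: k].
Qed.

Lemma cost_free {N} (K L : set (value N)) :
  (forall v, L v -> K v \/ exists z, v = fun _ _ => z) -> cost K 0 L.
Proof.
move=> h vs dvs hK; exists [::]; rewrite cats0; split => // v /h [/hK //|[z ->]].
exact: known_const.
Qed.

Lemma cost_seq {N} (K L M : set (value N)) t1 t2 :
  cost K t1 L -> cost (K `|` L)%classic t2 M -> cost K (t1 + t2) (L `|` M)%classic.
Proof.
move=> h1 h2 vs dvs hK; have [ws [d1 s1 k1]] := h1 vs dvs hK.
have [|xs [d2 s2 k2]] := h2 _ d1.
  by move=> v [/hK|/k1 //]; exact: known_cat.
exists (ws ++ xs); rewrite catA size_cat; split => //; first exact: leq_add.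
by move=> v [/k1|/k2 //]; exact: known_cat.
Qed.

Lemma cost_iter {N} (I : finType) (K : set (value N)) t (L : I -> set (value N)) :
  (forall i, cost K t (L i)) ->
  cost K (#|I| * t) [set v | exists i, L i v]%classic.
Proof.
move=> h.
suff H (s : seq I) : cost K (size s * t) [set v | exists2 i, i \in s & L i v]%classic.
  by have := H (enum I); rewrite -cardE; apply: cost_mono => // v [i iv]; exists i;
    rewrite ?mem_enum.
elim: s => [|i s IHs]; first by rewrite mul0n; apply: cost_free => v [].
rewrite /= mulSn.
apply: (@cost_mono _ K _ (L i `|` [set v | exists2 i, i \in s & L i v])%classic _
         (t + size s * t)) => //.
  by move=> v [j]; rewrite inE => /predU1P[->|js] jv; [left|right; exists j].
apply: cost_seq; first exact: h.
by apply: cost_mono IHs => // v; left.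
Qed.

Lemma cost_op {N} (K : set (value N)) o (x y z : value N) :
  K x -> (K y \/ exists c, y = fun _ _ => c) ->
  (forall A B, eval_op o (x A B) (y A B) = Some (z A B)) ->
  cost K 1 [set z]%classic.
Proof.
move=> Kx Ky hz vs dvs hK.
have ky : known vs y by case: Ky => [/hK //|[c ->]]; exact: known_const.
have [d k] := derivable_rcons dvs (hK _ Kx) ky hz.
by exists [:: z]; rewrite cats1; split => // v ->.
Qed.

(** Each term takes one multiplication by the constant [a i] and one addition; the empty sum is the
    free constant 0. *)
Lemma cost_lincomb {N} (I : finType) (K : set (value N)) (a : I -> int) (v : I -> value N) :
  (forall i, K (v i)) ->
  cost K (2 * #|I|) [set (fun A B => \sum_i a i * v i A B)]%classic.
Proof.
move=> hv.
suff H (s : seq I) : cost K (2 * size s) [set (fun A B => \sum_(i <- s) a i * v i A B)]%classic.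
  have := H (enum I); rewrite -cardE; apply: cost_mono => // w ->.
  by apply/funext => A; apply/funext => B; rewrite big_enum.
elim: s => [|i s IHs].
  apply: cost_free => w ->; right; exists 0.
  by apply/funext => A; apply/funext => B; rewrite big_nil.
pose x : value N := fun A B => v i A B * a i.
pose y : value N := fun A B => \sum_(i <- s) a i * v i A B.
have := @cost_seq _ K [set y]%classic ([set x] `|` [set (fun A B => (x A B + y A B)%R)])%classic
  (2 * size s) (1 + 1) IHs.
have H2 : cost (K `|` [set y])%classic (1 + 1)
    ([set x] `|` [set (fun A B => (x A B + y A B)%R)])%classic.
  apply: cost_seq.
    by apply: (@cost_op _ _ Mul (v i) (fun _ _ => a i)) => //; [left|right; exists (a i)].
  by apply: (@cost_op _ _ Add x y) => //; [right|left; left; right].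
move=> /(_ H2); apply: cost_mono => //=; first by rewrite mulnS addnC.
move=> w ->; right; right; apply/funext => A; apply/funext => B.
by rewrite big_cons /x mulrC.
Qed.

Definition entries {N} {I : finType} (X : I -> I -> value N) : set (value N) :=
  [set v | exists i j, v = X i j]%classic.

Definition vmul {N} {I : finType} (X Y : I -> I -> value N) (i k : I) : value N :=
  fun A B => \sum_j X i j A B * Y j k A B.

(** An arbitrary finite index type lets block matrices be indexed by a product type. *)
Definition mul_cost (I : finType) (t : nat) : Prop :=
  forall N (X Y : I -> I -> value N),
    cost (entries X `|` entries Y)%classic t (entries (vmul X Y)).

Lemma mul_cost_small (I : finType) : (#|I| <= 1)%N -> mul_cost I 1.
Proof.
move=> /fintype_le1P h N X Y.
have [i _|I0] := pickP (@predT I); last first.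
  apply: (@cost_mono _ (entries X `|` entries Y)%classic _ set0 _ 0) => //.
    by move=> v [i]; have := I0 i.
  by apply: cost_free => v [].
apply: (@cost_mono _ (entries X `|` entries Y)%classic _
         [set (fun A B => X i i A B * Y i i A B)]%classic _ 1) => //.
  move=> v [j [k ->]]; apply/funext => A; apply/funext => B.
  rewrite /vmul (bigD1 i) //= big1 ?addr0 => [|l]; last by rewrite (h i l) eqxx.
  by rewrite (h i j) (h i k).
apply: (@cost_op _ _ Mul (X i i) (Y i i)) => //; last left.
  by left; exists i, i.
by right; exists i, i.
Qed.

(** Zero padding: [f] embeds [J] into [I] with partial inverse [g], the added entries are free
    constants, and the product reappears as a block of the padded product. *)
Lemma mul_cost_leq (I J : finType) t : (#|J| <= #|I|)%N -> mul_cost I t -> mul_cost J t.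
Proof.
move=> le_JI h N X Y.
pose f (j : J) : I := enum_val (widen_ord le_JI (enum_rank j)).
pose g (i : I) : option J := [pick j | f j == i].
have f_inj : injective f.
  by move=> j k /enum_val_inj /(congr1 val) /= /val_inj /enum_rank_inj.
have fK : pcancel f g.
  move=> j; rewrite /g; case: pickP => [k /eqP /f_inj -> //|/(_ j)]; by rewrite eqxx.
pose pad (Z : J -> J -> value N) i k : value N :=
  if g i is Some j then if g k is Some l then Z j l else fun _ _ => 0 else fun _ _ => 0.
have padE Z j l : pad Z (f j) (f l) = Z j l by rewrite /pad !fK.
have hpad Z v : entries (pad Z) v -> entries Z v \/ exists z, v = fun _ _ => z.
  move=> [i [k ->]]; rewrite /pad.
  case: (g i) => [j|]; last by right; exists 0.
  case: (g k) => [l|]; last by right; exists 0.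
  by left; exists j, l.
apply: (@cost_mono _ (entries X `|` entries Y)%classic _
   ((entries (pad X) `|` entries (pad Y)) `|` entries (vmul (pad X) (pad Y)))%classic _ (0 + t)) => //.
  move=> v [j [l ->]]; right; exists (f j), (f l).
  apply/funext => A; apply/funext => B; rewrite /vmul.
  rewrite [RHS](bigID (mem (codom f))) /= [X in _ = _ + X]big1 ?addr0.
    rewrite (reindex_omap f g) => [|i /codomP[k ->]]; last by rewrite fK.
    by apply: eq_big => [k|k _]; rewrite ?padE // codom_f fK eqxx.
  move=> i; rewrite /pad fK; case gi : (g i) => [k|]; last by rewrite mul0r.
  by move: gi; rewrite /g; case: pickP => // x /eqP <- _; rewrite codom_f.
apply: cost_seq.
  apply: cost_free => v [/hpad[]|/hpad[]]; by [left; left|left; right|right].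
by apply: cost_mono (h N (pad X) (pad Y)) => // v; right.
Qed.

Lemma mulmx_in_ops_leq N t : mul_cost 'I_N t ->
  exists2 t', (t' <= t)%N & mulmx_in_ops N t'.
Proof.
move=> h.
pose X (i j : 'I_N) : value N := fun A _ => A i j.
pose Y (i j : 'I_N) : value N := fun _ B => B i j.
have [||ws [[p sp hp] st kn]] := h N X Y [::].
- by exists [::].
- move=> v [] [i [j ->]]; first by exists (LeftEntry i j).
  by exists (RightEntry i j).
exists (size p); first by rewrite sp.
have {kn} kn (ij : 'I_N * 'I_N) : known ws (vmul X Y ij.1 ij.2) by apply: kn; exists ij.1, ij.2.
have [out hout] := choice kn.
exists p, (fun i j => out (i, j)); split => // A B.
exists (results_of ws A B) => // i j.
by rewrite hout /vmul mxE.
Qed.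

(** * From bilinear rank to operation count *)

(* A rank-r decomposition of d times the matrix multiplication tensor. *)
Definition mm_algorithm (J : finType) (r : nat) (d : int) : Prop :=
  exists alpha beta gamma : 'I_r -> J -> J -> int,
    forall i j j' k k' i',
      \sum_s alpha s i j * beta s j' k * gamma s k' i' =
      d * ((i == i') && (j == j') && (k == k'))%:R.

(** The tensor is that of the trace of xyz; the coefficient of the entry [(w, u)] of z is the entry
    [(u, w)] of xy, whence the order of the indices of [gamma]. *)
Lemma mm_identity (J : finType) r d (alpha beta gamma : 'I_r -> J -> J -> int)
    (x y : J -> J -> int) u w :
  (forall i j j' k k' i',
      \sum_s alpha s i j * beta s j' k * gamma s k' i' =
      d * ((i == i') && (j == j') && (k == k'))%:R) ->
  \sum_s gamma s w u * ((\sum_(p : J * J) alpha s p.1 p.2 * x p.1 p.2) *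
                        (\sum_(p : J * J) beta s p.1 p.2 * y p.1 p.2)) =
  d * \sum_j x u j * y j w.
Proof.
move=> h.
transitivity (\sum_(p : J * J) \sum_(q : J * J)
   d * ((p.1 == u) && (p.2 == q.1) && (q.2 == w))%:R * (x p.1 p.2 * y q.1 q.2)).
  under eq_bigr do rewrite big_distrlr /= mulr_sumr.
  rewrite exchange_big; apply: eq_bigr => p _.
  under eq_bigr do rewrite mulr_sumr.
  rewrite exchange_big; apply: eq_bigr => q _.
  rewrite -h mulr_suml; apply: eq_bigr => s _; ring.
rewrite mulr_sumr -(pair_bigA _ (fun a b => \sum_(q : J * J)
   d * ((a == u) && (b == q.1) && (q.2 == w))%:R * (x a b * y q.1 q.2))) /=.
rewrite (bigD1 u) //= [X in _ + X]big1 ?addr0 => [|a /negbTE au]; last first.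
  by apply: big1 => b _; apply: big1 => q _; rewrite au mulr0 mul0r.
apply: eq_bigr => b _; rewrite (bigD1 (b, w)) //= !eqxx mulr1 big1 ?addr0 // => -[q1 q2] /=.
rewrite xpair_eqE (eq_sym b) => /negbTE ->; by rewrite mulr0 mul0r.
Qed.

(* In units of #|J| ^ 2 * #|I| ^ 2 operations: 2r each for the linear forms in the
   left blocks, in the right blocks and in the products, and 1 for the division
   by d. *)
Lemma mul_cost_step (I J : finType) r d t : d != 0 ->
  mm_algorithm J r d -> mul_cost I t ->
  mul_cost (J * I)%type (r * t + (6 * r + 1) * #|J| ^ 2 * #|I| ^ 2).
Proof.
move=> d0 [alpha [beta [gamma h]]] hI N X Y.
pose lc (a : 'I_r -> J -> J -> int) (Z : J * I -> J * I -> value N) s i k : value N :=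
  fun A B => \sum_(p : J * J) a s p.1 p.2 * Z (p.1, i) (p.2, k) A B.
pose M s := vmul (lc alpha X s) (lc beta Y s).
pose num u w i k : value N := fun A B => \sum_s gamma s w u * M s i k A B.
(* [mm_identity] is applied for each inner index [l]; the sums over the block index and over [l]
   then merge into one over [J * I]. *)
have numE u w i k A B : num u w i k A B = d * vmul X Y (u, i) (w, k) A B.
  rewrite /num /M /vmul /lc; under eq_bigr do rewrite mulr_sumr.
  rewrite exchange_big /=.
  under eq_bigr => l _ do
    rewrite (mm_identity (fun a b => X (a, i) (b, l) A B) (fun a b => Y (a, l) (b, k) A B) u w h).
  rewrite -mulr_sumr exchange_big /= pair_bigA /=.
  by congr (_ * _); apply: eq_bigr => -[].
pose L a Z : set (value N) :=
  [set v | exists x : 'I_r * (I * I), v = lc a Z x.1 x.2.1 x.2.2]%classic.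
pose LM : set (value N) := [set v | exists s, entries (M s) v]%classic.
have hL K a Z : (entries Z `<=` K)%classic ->
    cost K (#|{: 'I_r * (I * I)}| * (2 * #|{: J * J}|)) (L a Z).
  move=> ZK; apply: (cost_iter (L := fun x => [set lc a Z x.1 x.2.1 x.2.2]%classic)) => x.
  by apply: cost_lincomb => p; apply: ZK; exists (p.1, x.2.1), (p.2, x.2.2).
have hM K : (L alpha X `<=` K)%classic -> (L beta Y `<=` K)%classic ->
    cost K (#|'I_r| * t) LM.
  move=> LK LK'; apply: (cost_iter (L := fun s => entries (M s))) => s; apply: cost_mono (hI N (lc alpha X s) (lc beta Y s)) => //.
  by move=> v [] [i [k ->]]; [apply: LK|apply: LK']; exists (s, (i, k)).
have hO K : (LM `<=` K)%classic ->
    cost K (#|{: (J * I) * (J * I)}| * (2 * #|'I_r| + 1)) (entries (vmul X Y)).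
  move=> LK.
  pose O (x : (J * I) * (J * I)) : set (value N) :=
    ([set num x.1.1 x.2.1 x.1.2 x.2.2] `|` [set vmul X Y x.1 x.2])%classic.
  apply: (@cost_mono _ K _ [set v | exists x, O x v]%classic) (leqnn _) _ _ => //.
    by move=> v [x [y ->]]; exists (x, y); right.
  apply: cost_iter => -[[u i] [w k]] /=; apply: cost_seq.
    by apply: cost_lincomb => s; apply: LK; exists s, i, k.
  (* By [numE] the numerator is [d] times the wanted entry for all inputs, so the division never
     fails. *)
  apply: (@cost_op _ _ ExactDiv (num u w i k) (fun _ _ => d)); first by right.
    by right; exists d.
  by move=> A B /=; rewrite d0 numE dvdz_mulr //= mulrC mulzK.
pose K0 := (entries X `|` entries Y)%classic.
set K1 := (K0 `|` L alpha X)%classic.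
set K2 := (K1 `|` L beta Y)%classic.
have c4 := hO (K2 `|` LM)%classic (@subsetUr _ _ _).
have c3 := cost_seq (hM K2 _ (@subsetUr _ _ _)) c4.
have c2 := cost_seq (hL K1 beta Y _) (c3 _).
have c1 := cost_seq (hL K0 alpha X (@subsetUl _ _ _)) (c2 _ _).
apply: cost_mono (c1 _ _) => //.
- rewrite !card_prod card_ord; nia.
- by move=> v hv; right; right; right.
- by move=> v Yv; left; right.
- by move=> v Lv; left; right.
Qed.

(** * Matrix multiplication inside the disjointness tensor *)

Lemma sum_mul_eq (R : comRingType) (I : finType) (F : I -> R) (i : I) :
  \sum_j F j * (j == i)%:R = F i.
Proof.
rewrite (bigD1 i) //= eqxx mulr1 big1 ?addr0 // => j /negbTE ->.
by rewrite mulr0.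
Qed.

(** Test the identity on indicator functions of single q-subsets; [lambda] is absorbed into
    [alpha]. *)
Lemma trilinear_coefficients (U : finType) q r : trilinear_algorithm U q r ->
  exists alpha beta gamma : 'I_r -> qsubset U q -> int,
    forall A B C, \sum_s alpha s A * beta s B * gamma s C = (disjoint_triple A B C)%:R.
Proof.
move=> [lambda [alpha [beta [gamma h]]]].
exists (fun s A => lambda s * alpha s A), beta, gamma => A B C.
pose ind (X Y : qsubset U q) : int := (Y == X)%:R.
have indE F X : \sum_Y F Y * ind X Y = F X.
  exact: sum_mul_eq.
have := h (ind A) (ind B) (ind C).
under [RHS]eq_bigr do rewrite !indE.
move=> <-; rewrite /Delta (bigD1 A) //= [X in _ + X]big1 ?addr0 => [|A' /negbTE AA]; last first.
  by apply: big1 => B' _; apply: big1 => C' _; rewrite /ind AA !mul0r.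
rewrite (bigD1 B) //= [X in _ + X]big1 ?addr0 => [|B' /negbTE BB]; last first.
  by apply: big1 => C' _; rewrite /ind BB mulr0 mul0r.
rewrite big_mkcond (bigD1 C) //= [X in _ + X]big1 ?addr0 => [|C' /negbTE CC]; last first.
  by rewrite /ind CC mulr0 if_same.
by rewrite /ind !eqxx !mulr1; case: disjoint_triple.
Qed.

Section DisjointnessMatrix.
Variables (X Y : finType).

Definition nowhere_equal (s t : {ffun X -> Y}) : bool := [forall x, s x != t x].

(* Up to the factor (#|Y| - 1) ^ #|X|, the inverse of the matrix of
   nowhere_equal: both are tensor powers, of J - I and of J - (#|Y| - 1) I. *)
Definition disjointness_adj (s t : {ffun X -> Y}) : int :=
  \prod_x (1 - (#|Y|%:Z - 1) * (s x == t x)%:R).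

Lemma nowhere_equalC s t : nowhere_equal s t = nowhere_equal t s.
Proof. by apply: eq_forallb => x; rewrite eq_sym. Qed.

(** Both sides factor over the coordinates. In each, with b = [#|Y|] and J the all-ones matrix, J^2
    = bJ gives (J - I)(J - (b-1)I) = (b-1)I. *)
Lemma sum_disjointness_adj s u :
  \sum_t (nowhere_equal s t)%:R * disjointness_adj t u =
  (#|Y|%:Z - 1) ^+ #|X| * (s == u)%:R.
Proof.
have -> : (#|Y|%:Z - 1) ^+ #|X| * (s == u)%:R =
    \prod_(x : X) ((#|Y|%:Z - 1) * (s x == u x)%:R).
  rewrite big_split /= prodr_const; congr (_ * _).
  have [->|/eqP su] := eqVneq s u; first by rewrite big1 // => x _; rewrite eqxx.
  have [x sx] : exists x, s x != u x.
    by apply/existsP; rewrite -negb_forall; apply/forallP => e; apply/su/ffunP => x; apply/eqP.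
  by rewrite (bigD1 x) //= (negbTE sx) mul0r.
transitivity (\prod_(x : X) \sum_(y : Y)
    (s x != y)%:R * (1 - (#|Y|%:Z - 1) * (y == u x)%:R)); last first.
  apply: eq_bigr => x _.
  rewrite (eq_bigr (fun y => (1 - 1 * (y == s x)%:R) -
      (#|Y|%:Z - 1) * ((s x != y)%:R * (y == u x)%:R))); last first.
    by move=> y _; rewrite (eq_sym (s x)); case: (y == s x) => /=; ring.
  rewrite !sumrB -[Z in _ - Z]mulr_sumr sumr_const.
  have := sum_mul_eq (fun y => (s x != y)%:R : int) (u x).
  have := sum_mul_eq (fun=> 1 : int) (s x).
  rewrite /= => -> ->.
  by case: (s x == u x) => /=; ring.
(* Expanding a product of sums over [Y] gives a sum over the functions [t]. *)
rewrite bigA_distr_bigA /=; apply: eq_bigr => t _.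
rewrite big_split /=; congr (_ * _); rewrite /nowhere_equal.
case: forallP => [h|h]; first by rewrite big1 // => x _; rewrite h.
have [x] : exists x, s x == t x.
  by apply: contrapT => k; apply: h => x; apply/negP => e; apply: k; exists x.
by move=> e; rewrite (bigD1 x) //= e mul0r.
Qed.

End DisjointnessMatrix.

Section MatrixTensor.
Variables (X Y U : finType) (place : 'I_3 * (X * Y) -> U).
Hypothesis place_inj : injective place.

Definition graph (c : 'I_3) (s : {ffun X -> Y}) : {set U} :=
  [set place (c, (x, s x)) | x : X]%SET.

Lemma card_graph c s : #|graph c s| = #|X|.
Proof. by rewrite card_imset // => x y /place_inj []. Qed.

(** Graphs in different copies never meet; in the same copy they meet exactly over the points where
    the functions agree. *)
Lemma disjoint_graph c c' s t :
  (graph c s :&: graph c' t == finset.set0)%SET = ((c == c') ==> nowhere_equal s t).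
Proof.
apply/eqP/implyP => [h /eqP cc|h].
  apply/forallP => x; apply/eqP => st.
  have : place (c, (x, s x)) \in (graph c s :&: graph c' t)%SET.
    by rewrite finset.in_setI imset_f //= cc st imset_f.
  by rewrite h finset.in_set0.
apply/finset.setP => v; rewrite finset.in_set0 finset.in_setI; apply/negP.
move=> /andP[/imsetP[x _ ->] /imsetP[y _ /place_inj[cc xy st]]].
have /forallP /(_ x) : nowhere_equal s t by apply: h; rewrite cc.
by rewrite st xy eqxx.
Qed.

Lemma card_graphU c c' s t : c != c' -> #|(graph c s :|: graph c' t)%SET| == (#|X| + #|X|)%N.
Proof.
move=> cc; rewrite cardsU !card_graph.
have /eqP -> : (graph c s :&: graph c' t == finset.set0)%SET.
  by rewrite disjoint_graph (negbTE cc).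
by rewrite cards0 subn0.
Qed.

(** Correcting the second index of each of the three families by [disjointness_adj] undoes every
    twist exactly once, at the price of one factor (b-1)^p each, where b = [#|Y|] and p = [#|X|]. *)
Lemma mm_of_trilinear r : trilinear_algorithm U (#|X| + #|X|) r ->
  mm_algorithm {ffun X -> Y} r (((#|Y|%:Z - 1) ^+ #|X|) ^+ 3).
Proof.
move=> /trilinear_coefficients [alpha [beta [gamma h]]].
pose c0 : 'I_3 := inord 0; pose c1 : 'I_3 := inord 1; pose c2 : 'I_3 := inord 2.
have n01 : c0 != c1 by rewrite -val_eqE /= !inordK.
have n12 : c1 != c2 by rewrite -val_eqE /= !inordK.
have n20 : c2 != c0 by rewrite -val_eqE /= !inordK.
pose Q c c' (cc : c != c') s t : qsubset U (#|X| + #|X|) :=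
    exist _ (graph c s :|: graph c' t)%SET (card_graphU s t cc).
(* Each copy is used by exactly two of the three sets and so contributes one condition. *)
have hQ i j' j k' k i' :
    disjoint_triple (Q _ _ n01 i j') (Q _ _ n12 j k') (Q _ _ n20 k i') =
    [&& nowhere_equal i i', nowhere_equal j j' & nowhere_equal k k'].
  rewrite /disjoint_triple /= !finset.setIUl !finset.setIUr !finset.setU_eq0 !disjoint_graph.
  rewrite !eqxx (eq_sym c0 c2) (eq_sym c1 c0).
  rewrite (negbTE n01) (negbTE n12) (negbTE n20) /= !andbT.
  by rewrite (nowhere_equalC j) (nowhere_equalC k) andbCA andbA.
pose E := @disjointness_adj X Y.
exists (fun s i j => \sum_j' alpha s (Q _ _ n01 i j') * E j' j),
  (fun s j k => \sum_k' beta s (Q _ _ n12 j k') * E k' k),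
  (fun s k i => \sum_i' gamma s (Q _ _ n20 k i') * E i' i) => i j j1 k k1 i1.
transitivity (\sum_j' \sum_k' \sum_i'
   ((nowhere_equal j1 j')%:R * E j' j) * ((nowhere_equal k1 k')%:R * E k' k) *
   ((nowhere_equal i i')%:R * E i' i1)).
  under eq_bigr do rewrite big_distrlr /= mulr_suml.
  rewrite exchange_big; apply: eq_bigr => j' _.
  under eq_bigr do rewrite big_distrlr /=.
  rewrite exchange_big; apply: eq_bigr => k' _.
  rewrite exchange_big; apply: eq_bigr => i' _.
  transitivity ((disjoint_triple (Q _ _ n01 i j') (Q _ _ n12 j1 k') (Q _ _ n20 k1 i'))%:R
     * (E j' j * E k' k * E i' i1)).
    by rewrite -h mulr_suml; apply: eq_bigr => s _; ring.
  rewrite hQ -!mulnb !natrM; ring.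
under eq_bigr do under eq_bigr do rewrite -mulr_sumr sum_disjointness_adj.
under eq_bigr do rewrite -mulr_suml -mulr_sumr sum_disjointness_adj.
rewrite -mulr_suml -mulr_suml sum_disjointness_adj.
rewrite -!mulnb !natrM (eq_sym j) (eq_sym k); ring.
Qed.

End MatrixTensor.

(** * Exponents *)

Lemma bigO_powerP (R : realType) (a : nat -> nat) (e : R) :
  bigO_power a e <->
  exists C : R, exists n0 : nat, forall n, (n0 <= n)%N -> (a n)%:R <= C * n%:R `^ e.
Proof.
split.
  move=> /eqO_exP[C C0 [n0 _ h]]; exists C, n0 => n n0n.
  by have := h n n0n; rewrite /= normr_nat ger0_norm ?powR_ge0.
move=> [C [n0 h]]; apply/eqO_exP; exists (Num.max C 1); first by rewrite lt_max ltr01 orbT.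
exists n0 => // n n0n; rewrite /= normr_nat ger0_norm ?powR_ge0 //.
by apply: le_trans (h n n0n) _; rewrite ler_wpM2r ?powR_ge0 // le_max lexx.
Qed.

Fixpoint strassen_cost (m r k : nat) : nat :=
  if k is k'.+1 then r * strassen_cost m r k' + (6 * r + 1) * m ^ 2 * (m ^ k') ^ 2
  else 1.

Lemma mul_cost_pow (J : finType) r d k : d != 0 -> mm_algorithm J r d ->
  mul_cost 'I_(#|J| ^ k) (strassen_cost #|J| r k).
Proof.
move=> d0 h; elim: k => [|k IHk] /=; first by apply: mul_cost_small; rewrite card_ord.
have := mul_cost_step d0 h IHk; rewrite card_ord.
by apply: mul_cost_leq; rewrite card_prod !card_ord expnS.
Qed.

Lemma powRXn (R : realType) (x w : R) k : 0 <= x -> (x `^ w) ^+ k = (x ^+ k) `^ w.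
Proof. by move=> x0; rewrite -!powR_mulrn ?powR_ge0 // -!powRrM mulrC. Qed.

(** The linear work grows by a factor [m ^ 2] per level; the strict inequality [m ^ 2 < B] makes its
    total a convergent geometric series relative to [B ^ k]. *)
Lemma strassen_cost_le (R : realType) m r (B : R) : m%:R ^+ 2 < B -> r%:R <= B ->
  exists C : R, 0 <= C /\ forall k, (strassen_cost m r k)%:R <= C * B ^+ k.
Proof.
move=> mB rB.
pose K : R := ((6 * r + 1) * m ^ 2)%:R; pose C := K / (B - m%:R ^+ 2).
have Bm : 0 < B - m%:R ^+ 2 by rewrite subr_gt0.
have C0 : 0 <= C by rewrite divr_ge0 ?ler0n // ltW.
have KE : K = C * (B - m%:R ^+ 2) by rewrite divfK // gt_eqF.
exists (1 + C); split; first by rewrite addr_ge0.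
move=> k; suff: (strassen_cost m r k)%:R + C * (m%:R ^+ k) ^+ 2 <= (1 + C) * B ^+ k.
  by apply: le_trans; rewrite lerDl mulr_ge0 // exprn_even_ge0.
elim: k => [|k IHk] /=; first by rewrite !expr0 expr1n !mulr1.
(* The term C m^(2k) absorbs the linear work: K = C (B - m^2). *)
rewrite natrD natrM [X in _ + X + _]natrM -/K KE !natrX.
have : r%:R * (strassen_cost m r k)%:R <= B * (strassen_cost m r k)%:R.
  by rewrite ler_wpM2r.
have : B * ((strassen_cost m r k)%:R + C * (m%:R ^+ k) ^+ 2) <= B * ((1 + C) * B ^+ k).
  by rewrite ler_wpM2l // (le_trans _ (ltW mB)) // exprn_even_ge0.
rewrite !exprS; lra.
Qed.

Lemma mulmx_exponent_of_mm (R : realType) (J : finType) r d (w : R) : d != 0 ->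
  mm_algorithm J r d -> (1 < #|J|)%N -> 2 < w -> r%:R <= #|J|%:R `^ w ->
  mulmx_exponent w.
Proof.
move=> d0 h; set m := #|J| => m1 w2 rm.
have m0 : 0 < m%:R :> R by rewrite ltr0n; lia.
have [||C [C0 hC]] := @strassen_cost_le R m r (m%:R `^ w) => //.
  by rewrite -powR_mulrn ?ltW // /powR gt_eqF // ltr_expR ltr_pM2r // ln_gt0 // ltr1n.
have hN (N : nat) : exists t, (t <= strassen_cost m r (trunc_log m N).+1)%N /\ mulmx_in_ops N t.
  have le_N : (N <= m ^ (trunc_log m N).+1)%N by apply/ltnW/trunc_log_ltn.
  have [|t le_t ht] := @mulmx_in_ops_leq N (strassen_cost m r (trunc_log m N).+1).
    by apply: mul_cost_leq (mul_cost_pow d0 h); rewrite !card_ord.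
  by exists t.
have [t ht] := choice hN; exists t; split; first by move=> N; case: (ht N).
(* Rounding [N] up to a power of [m] gives at most [m * N], which costs the factor [m ^ w]. The
   bound on that power fails at [N = 0], hence the threshold 1. *)
apply/bigO_powerP; exists (C * m%:R `^ w), 1%N => N N0.
have [tN _] := ht N.
apply: (le_trans (_ : _ <= (strassen_cost m r (trunc_log m N).+1)%:R)); first by rewrite ler_nat.
apply: (le_trans (hC _)); rewrite exprS mulrA ler_wpM2l ?mulr_ge0 ?powR_ge0 //.
rewrite powRXn ?(ltW m0) // -natrX; apply: ge0_ler_powR; rewrite ?nnegrE ?ler0n //; first lra.
by rewrite ler_nat trunc_logP.
Qed.

Lemma mm_of_trilinear_ord p b r : trilinear_algorithm 'I_(3 * (p * b)) (p + p) r ->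
  mm_algorithm {ffun 'I_p -> 'I_b} r (((b%:Z - 1) ^+ p) ^+ 3).
Proof.
have card3 : #|{: 'I_3 * ('I_p * 'I_b)}| = (3 * (p * b))%N by rewrite !card_prod !card_ord.
move=> h.
have := @mm_of_trilinear _ _ _ (fun x => cast_ord card3 (enum_rank x)) _ r.
rewrite !card_ord; apply => //.
by move=> x y /cast_ord_inj /enum_rank_inj.
Qed.

(** An empty sum cannot produce the diagonal coefficient [d]. *)
Lemma mm_rank_gt0 (J : finType) r d : (0 < #|J|)%N -> d != 0 -> mm_algorithm J r d -> (0 < r)%N.
Proof.
move=> /card_gt0P[j _] d0 [a [b [c h]]]; rewrite lt0n; apply/eqP => r0; subst r.
by have := h j j j j j j; rewrite big_ord0 !eqxx mulr1 => /esym/eqP; rewrite (negbTE d0).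
Qed.

Theorem theorem5 (R : realType) (tau c : R) (tau_gt0 : 0 < tau) (c_ge0 : 0 <= c)
    (algorithms : forall q : nat, (0 < q)%N ->
      exists r : nat -> nat,
        (forall n : nat, trilinear_algorithm 'I_n q (r n)) /\
        bigO_power r (3 * q%:R * (1 / 2 - tau) + c)) :
  (omega R <= (3 - tau)%:E)%E.
Proof.
pose p := (Num.truncn (c / tau)).+1.
have p_gt : c < p%:R * tau by rewrite -ltr_pdivrMr // truncnS_gt.
have [//|r [hr /bigO_powerP[C [n0 hC]]]] := algorithms (p + p)%N.
set e := (_ + c) in hC.
pose delta := p%:R * tau - c.
have delta0 : 0 < delta by rewrite subr_gt0.
(* With q = 2p the exponent is p(3 - 6 tau) + c; trading one p tau for c leaves the slack
   [delta]. *)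
have eE : e = p%:R * (3 - 5 * tau) - delta by rewrite /e /delta natrD; field.
(* At n = 3pb the bound C n^e is at most M b^e; the absolute value is there because the sign of [C]
   is unknown. *)
pose M := `|C| * (3 * p%:R) `^ e.
have M0 : 0 <= M by rewrite mulr_ge0 // powR_ge0.
(* The first summand makes b^delta exceed [M], [n0] puts n = 3pb beyond the threshold, and [b >= 2]
   gives [d != 0] and [1 < #|J|]. *)
pose b := (Num.truncn (M `^ delta^-1) + n0).+2%N.
have hb : M < b%:R `^ delta.
  have : M `^ delta^-1 < b%:R.
    by apply: (lt_le_trans (truncnS_gt _)); rewrite ler_nat ltnS leqW // leq_addr.
  move=> h; have := gt0_ltr_powR delta0 _ _ h.
  rewrite !nnegrE powR_ge0 ler0n => /(_ isT isT).
  by rewrite -powRrM mulVf ?gt_eqF // powRr1.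
have b0 : 0 < b%:R :> R by rewrite ltr0n.
pose J : finType := {ffun 'I_p -> 'I_b}.
have cardJ : #|{: J}| = (b ^ p)%N by rewrite card_ffun !card_ord.
pose d : int := ((b%:Z - 1) ^+ p) ^+ 3.
have d0 : d != 0 by rewrite !expf_neq0 // subr_eq0.
have mm : mm_algorithm J (r (3 * (p * b))%N) d by exact: mm_of_trilinear_ord.
set r0 := r _ in mm.
have r_lt : r0%:R < (#|{: J}|%:R : R) `^ (3 - 5 * tau).
  rewrite cardJ natrX -powR_mulrn ?ltW // -powRrM.
  apply: (le_lt_trans (hC _ _)); first by rewrite /b /p; nia.
  rewrite natrM natrM mulrA powRM ?mulr_ge0 ?ler0n //.
  have -> : p%:R * (3 - 5 * tau) = e + delta by rewrite eE subrK.
  rewrite powRD ?(gt_eqF b0) ?implybT // mulrA [ltRHS]mulrC ltr_pM2r ?powR_gt0 //.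
  apply: le_lt_trans hb; rewrite ler_wpM2r ?powR_ge0 //; exact: ler_norm.
have J1 : (1 < #|{: J}|)%N.
  by rewrite cardJ -{1}(exp1n p) ltn_exp2r.
have J1' : 1 <= (#|{: J}|%:R : R) by rewrite ler1n; lia.
have r0_gt0 : (0 < r0)%N by apply: mm_rank_gt0 d0 mm; lia.
(* For [tau >= 1] the exponent 3 - 5 tau is negative, and [r_lt] would force the positive integer
   [r0] below 1. *)
have tau1 : tau < 1.
  rewrite ltNge; apply/negP => tau1.
  have : 1 < (#|{: J}|%:R : R) `^ 0.
    apply: (le_lt_trans (_ : 1 <= r0%:R)); first by rewrite ler1n.
    by apply: (lt_le_trans r_lt); rewrite ler_powR //; lra.
  by rewrite powRr0 ltxx.
apply: ereal_inf_lbound; exists (3 - tau) => //=.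
apply: (mulmx_exponent_of_mm d0 mm) => //; first lra.
by apply: (le_trans (ltW r_lt)); rewrite ler_powR //; lra.
Qed.
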